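(* Let $(G,u)$ be an Archimedean norm-complete dimension group with order-unit, let $S$ be its state space and $\phi\colon G\to\mathrm{Aff}(S)$ the natural map. Then the map $q\mapsto\{x\in G:\phi(x)\leq q\}$ determines an isomorphism (of ordered monoids) from $\Sigma(G,u)$ onto $\mathbf{\Lambda}_{\mathrm{cl}}(G)$, and its inverse is the map $\mathfrak{a}\mapsto\bigvee\phi[\mathfrak{a}]$.
   Context: A partially ordered abelian group is an abelian group $G$ with a translation-invariant partial order; $G^+=\{x\in G: x\ge0\}$; $\mathbb{N}$ is the set of positive integers. An order-unit is $u\in G^+$ such that for every $x\in G$ there is $n\in\mathbb{N}$ with $x\leq nu$. $G$ is directed if any two elements have a common upper bound; unperforated if for all $m\in\mathbb{N}$ and $x\in G$, $mx\geq0$ implies $x\geq0$; $G$ has interpolation if whenever $a_0,a_1\leq b_0,b_1$ there is $c$ with $a_0,a_1\leq c\leq b_0,b_1$. A dimension group is a directed unperforated partially ordered abelian group with interpolation. $G$ is Archimedean if for all $a,b\in G$, ($na\leq b$ for all integers $n\geq0$) implies $a\leq0$. The canonical norm on $(G,u)$ is $\|x\|_u=\inf\{k/n: k\in\mathbb{Z},\,k\ge0,\ n\in\mathbb{N},\ -ku\leq nx\leq ku\}$; $(G,u)$ is norm-complete if every Cauchy sequence for $\|\cdot\|_u$ converges in $G$. The state space $S$ is the set of all positive group homomorphisms $s\colon G\to\mathbb{R}$ with $s(u)=1$, a compact convex subset of $\mathbb{R}^G$; $\mathrm{Aff}(S)$ is the group of affine continuous real functions on $S$, and $\phi(x)(s)=s(x)$.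 An interval of $G$ is a nonempty upward directed lower subset; $\mathbf{\Lambda}(G)$ is the set of all intervals, with addition $\mathfrak{a}+\mathfrak{b}=\{z\in G: z\leq x+y\text{ for some }x\in\mathfrak{a},\,y\in\mathfrak{b}\}$ and ordered by inclusion. $\mathbf{\Lambda}_{\mathrm{cl}}(G)$ is the set of intervals closed for the topology of $\|\cdot\|_u$; it is an ordered submonoid of $\mathbf{\Lambda}(G)$. For $\mathfrak{a}\in\mathbf{\Lambda}(G)$, $\bigvee\phi[\mathfrak{a}]\colon S\to\mathbb{R}\cup\{+\infty\}$ is the pointwise supremum of $\{\phi(x):x\in\mathfrak{a}\}$. $\Sigma(G,u)=\{\bigvee\phi[\mathfrak{a}]:\mathfrak{a}\in\mathbf{\Lambda}(G)\}$, which is a monoid under pointwise addition, ordered pointwise. *)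

(* Defs.v *)
From HB Require Import structures.
From mathcomp Require Import all_boot all_order all_algebra.
From mathcomp Require Import all_classical all_reals all_analysis.

Set Implicit Arguments.
Unset Strict Implicit.
Unset Printing Implicit Defensive.

Import Order.TTheory GRing.Theory Num.Theory.
Import numFieldNormedType.Exports.

Local Open Scope classical_set_scope.
Local Open Scope ring_scope.

(* A [porderZmodType] carries an abelian group structure and a partial order,
   with no compatibility between the two; hence this predicate. *)
Definition partially_ordered_group (G : porderZmodType) : Prop :=
  forall x y z : G, x <= y -> x + z <= y + z.

Definition order_unit (G : porderZmodType) (u : G) : Prop :=
  0 <= u /\ forall x : G, exists n : nat, (0 < n)%N /\ x <= u *+ n.

Definition directed_group (G : porderZmodType) : Prop :=
  forall x y : G, exists z : G, x <= z /\ y <= z.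

Definition unperforated (G : porderZmodType) : Prop :=
  forall (m : nat) (x : G), (0 < m)%N -> 0 <= x *+ m -> 0 <= x.

Definition interpolation (G : porderZmodType) : Prop :=
  forall a0 a1 b0 b1 : G,
    a0 <= b0 -> a0 <= b1 -> a1 <= b0 -> a1 <= b1 ->
    exists c : G, [/\ a0 <= c, a1 <= c, c <= b0 & c <= b1].

Definition dimension_group (G : porderZmodType) : Prop :=
  [/\ partially_ordered_group G, directed_group G, unperforated G
    & interpolation G].

Definition archimedean_group (G : porderZmodType) : Prop :=
  forall a b : G, (forall n : nat, a *+ n <= b) -> a <= 0.

Definition unorm (R : realType) (G : porderZmodType) (u x : G) : R :=
  inf [set r : R | exists k n : nat,
         [/\ (0 < n)%N, - (u *+ k) <= x *+ n, x *+ n <= u *+ k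
           & r = k%:R / n%:R]].

Definition norm_cauchy (R : realType) (G : porderZmodType) (u : G)
    (x : nat -> G) : Prop :=
  forall e : R, 0 < e -> exists N : nat, forall m n : nat,
    (N <= m)%N -> (N <= n)%N -> unorm R u (x m - x n) < e.

Definition norm_complete (R : realType) (G : porderZmodType) (u : G) : Prop :=
  forall x : nat -> G, norm_cauchy R u x ->
    exists l : G, unorm R u (x n - l) @[n --> \oo] --> (0 : R).

(* [normed R u] is a copy of [G] with the topology of the canonical norm. *)
Definition normed (R : realType) (G : porderZmodType) (u : G) : Type := G.

Definition norm_open (R : realType) (G : porderZmodType) (u : G)
    (A : set G) : Prop :=
  forall x, A x -> exists2 e : R, 0 < e & [set y | unorm R u (x - y) < e] `<=` A.

Arguments norm_open R {G} u A.

Section NormTopology.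
Context (R : realType) (G : porderZmodType) (u : G).

HB.instance Definition _ := Choice.copy (normed R u) G.

Let norm_openT : norm_open R u setT.
Proof. by move=> x _; exists 1. Qed.

Let norm_openI : setI_closed (norm_open R u : set_system G).
Proof.
move=> A B oA oB x [/oA[e e0 eA] /oB[d d0 dB]].
exists (Num.min e d); first by rewrite lt_min e0.
by move=> y /=; rewrite lt_min => /andP[xye xyd]; split; [exact: eA|exact: dB].
Qed.

Let norm_open_bigU (I : Type) (f : I -> set G) :
  (forall i, norm_open R u (f i)) -> norm_open R u (\bigcup_i f i).
Proof.
move=> of_ x [i _ /of_[e e0 ef]]; exists e => // y /ef fy.
by exists i.
Qed.

HB.instance Definition _ := isOpenTopological.Build (normed R u)
  norm_openT norm_openI norm_open_bigU.

Lemma norm_openE (A : set (normed R u)) : open A <-> norm_open R u A.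
Proof.
split=> [oA x Ax|oA].
  have : nbhs (x : normed R u) A by exact: open_nbhs_nbhs.
  by rewrite /nbhs/= => -[B [oB Bx BA]]; have [e e0 eB] := oB _ Bx;
     exists e => // y /eB /BA.
by rewrite openE => x Ax; exists A; split.
Qed.

End NormTopology.

(* Positivity of a homomorphism [s] means that it maps [G^+] into [R^+]. *)
Definition states (R : realType) (G : porderZmodType) (u : G) :
    set {ptws G -> R} :=
  [set s | [/\ forall x y : G, s (x + y) = s x + s y,
               forall x : G, 0 <= x -> 0 <= s x
             & s u = 1]].
Arguments states R {G} u.

Definition affine (R : realType) (G : porderZmodType) (u : G)
    (f : states R u -> R) : Prop :=
  forall (s t v : states R u) (l : R), 0 <= l -> l <= 1 ->
    (forall x : G, val v x = l * val s x + (1 - l) * val t x) ->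
    f v = l * f s + (1 - l) * f t.

(* [states R u], as a type, has the topology induced by the product topology. *)
Definition Aff (R : realType) (G : porderZmodType) (u : G) :
    set (states R u -> R) :=
  [set f | affine f /\ continuous f].
Arguments Aff R {G} u.

Lemma evaluation_Aff (R : realType) (G : porderZmodType) (u x : G) :
  Aff R u (fun s => val s x).
Proof.
split=> [s t v l _ _ ->//|s].
apply: (@continuous_comp (states R u) {ptws G -> R} R set_val (fun f => f x)).
  exact: initial_continuous.
exact: (@proj_continuous G (fun _ => R) x).
Qed.

Arguments evaluation_Aff R {G} u x.

Definition phi (R : realType) (G : porderZmodType) (u x : G) : Aff R u :=
  SigSub (mem_set (evaluation_Aff R u x)).
Arguments phi R {G} u x.

Definition Lambda (G : porderZmodType) : set (set G) :=
  [set a | [/\ a !=set0,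
               forall x y, a x -> a y -> exists z, [/\ a z, x <= z & y <= z]
             & forall x y, a y -> x <= y -> a x]].
Arguments Lambda G : clear implicits.

Definition Lambda_add (G : porderZmodType) (a b : set G) : set G :=
  [set z | exists x y, [/\ a x, b y & z <= x + y]].

Definition Lambda_cl (R : realType) (G : porderZmodType) (u : G) :
    set (set G) :=
  [set a | Lambda G a /\ closed (a : set (normed R u))].
Arguments Lambda_cl R {G} u.

Definition sup_phi (R : realType) (G : porderZmodType) (u : G) (a : set G) :
    states R u -> \bar R :=
  fun s => ereal_sup [set (val (phi R u x) s)%:E | x in a].
Arguments sup_phi R {G} u a s.

Definition Sigma (R : realType) (G : porderZmodType) (u : G) :
    set (states R u -> \bar R) :=
  sup_phi R u @` Lambda G.
Arguments Sigma R {G} u.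

Record ordered_structure (T : Type) := OrderedStructure {
  os_dom : set T;
  os_zero : T;
  os_add : T -> T -> T;
  os_le : T -> T -> Prop
}.

Record ordered_monoid (T : Type) (M : ordered_structure T) : Prop := {
  om_zero : os_dom M (os_zero M);
  om_add : forall x y, os_dom M x -> os_dom M y -> os_dom M (os_add M x y);
  om_addA : forall x y z, os_dom M x -> os_dom M y -> os_dom M z ->
    os_add M x (os_add M y z) = os_add M (os_add M x y) z;
  om_addC : forall x y, os_dom M x -> os_dom M y ->
    os_add M x y = os_add M y x;
  om_add0 : forall x, os_dom M x -> os_add M (os_zero M) x = x;
  om_refl : forall x, os_dom M x -> os_le M x x;
  om_anti : forall x y, os_dom M x -> os_dom M y ->
    os_le M x y -> os_le M y x -> x = y;
  om_trans : forall x y z, os_dom M x -> os_dom M y -> os_dom M z ->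
    os_le M x y -> os_le M y z -> os_le M x z;
  om_leD : forall x y z, os_dom M x -> os_dom M y -> os_dom M z ->
    os_le M x y -> os_le M (os_add M x z) (os_add M y z)
}.

Record ordered_monoid_iso (T U : Type) (M : ordered_structure T)
    (N : ordered_structure U) (f : T -> U) : Prop := {
  omi_source : ordered_monoid M;
  omi_target : ordered_monoid N;
  omi_bij : set_bij (os_dom M) (os_dom N) f;
  omi_zero : f (os_zero M) = os_zero N;
  omi_add : forall x y, os_dom M x -> os_dom M y ->
    f (os_add M x y) = os_add N (f x) (f y);
  omi_le : forall x y, os_dom M x -> os_dom M y ->
    os_le M x y <-> os_le N (f x) (f y)
}.

Definition Sigma_structure (R : realType) (G : porderZmodType) (u : G) :
    ordered_structure (states R u -> \bar R) :=
  {| os_dom := Sigma R u;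
     os_zero := fun=> 0%E;
     os_add := fun p q s => (p s + q s)%E;
     os_le := fun p q => forall s, (p s <= q s)%E |}.

Definition Lambda_cl_structure (R : realType) (G : porderZmodType) (u : G) :
    ordered_structure (set G) :=
  {| os_dom := Lambda_cl R u;
     os_zero := [set z | z <= 0];
     os_add := @Lambda_add G;
     os_le := fun a b => a `<=` b |}.

Definition phi_below (R : realType) (G : porderZmodType) (u : G)
    (q : states R u -> \bar R) : set G :=
  [set x | forall s, ((val (phi R u x) s)%:E <= q s)%E].
Arguments phi_below R {G} u q.
Arguments Sigma_structure R {G} u.
Arguments Lambda_cl_structure R {G} u.

(* Main.v *)
From mathcomp Require Import all_boot all_order all_algebra.
From mathcomp Require Import all_classical all_reals all_analysis.
From mathcomp Require Import lra.
Require Import Defs.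

Set Implicit Arguments.
Unset Strict Implicit.
Unset Printing Implicit Defensive.

Import Order.TTheory GRing.Theory Num.Theory.
Import numFieldNormedType.Exports.

Local Open Scope classical_set_scope.
Local Open Scope ring_scope.

(** The two maps are compared through one operation on intervals. Fix the scale
    2^-k and call an element [x] small when 2^k x <= u; let [lclosure a] be the
    set of the [x] such that, at every scale, [x - y] is small for some [y] of
    [a]. For an interval [a], this one-sided closure is the closure of [a] for
    the canonical norm, because a small [x] is bounded by a small [c] that is
    also positive ([small_directed]); so [x - c] lies below [y], hence in [a],
    and is close to [x].

    The main fact is [phi_below_sup]: phi(x) <= \/phi[a] holds exactly when [x]
    is in [lclosure a]. One direction is the monotonicity of states. For the
    other one, suppose that [x - y] is small for no [y] of [a] at some scale.
    The elements w(y) = u - 2^k (x - y) form an increasing family without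
    positive member, so the cone of all [g] with g + m w(y) >= 0 for some [m]
    and [y] contains no negative multiple of [u]. A maximal cone with
    this property that contains it is total, and it yields a state that is nonpositive on all w(y), which
    contradicts phi(x) <= \/phi[a] ([positive_of_states]). The family being
    directed, one extension of cones thus does the work of a separation theorem
    followed by a compactness argument on the state space.

    Norm-completeness enters in [lclosure_add] alone: an
    element [x] of the closure of [a + b] is the sum of an element [p] of the
    closure of [a] and of an element of the closure of [b]. Interpolation
    produces approximations of [p], each one close to the previous one, and the
    limit is [p]. This shows that closed intervals are stable under addition.
    It also shows that the closure of an interval [a] is directed: the elements
    below -x0 and -x1 form a closed interval [b], and if x0 and x1 belong to the
    closure of [a], then 0 belongs to that of [a + b]; the resulting [p] is an
    upper bound of x0 and x1.

    Hence phi_below (\/phi[a]) is the closure of [a], which is [a] when [a] is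
    closed; the equality \/phi[phi_below q] = q is formal; and both maps
    preserve the structure because suprema of intervals are additive
    ([sup_phi_add]). *)

(** * Cones and states *)

Section Cones.
Context (G : zmodType) (u : G).

(** The positive cones of those preorders of the group for which [u] is an
    order unit and [u *+ n] is nonpositive for no positive [n]. *)
Definition unit_cone (C : set G) : Prop :=
  [/\ C 0, forall x y, C x -> C y -> C (x + y),
      forall x, exists n : nat, C (u *+ n - x)
    & forall n : nat, ~ C (- (u *+ n.+1))].

Lemma unit_cone_mulrn C x n : unit_cone C -> C x -> C (x *+ n).
Proof.
case=> C0 CD _ _ Cx; elim: n => [|n IH]; first by rewrite mulr0n.
by rewrite mulrSr; exact: CD.
Qed.

(** A maximal cone is total: if neither [x] nor [- x] belongs to it, then some
    [c + x *+ m] and some [d - x *+ p] are negative multiples of [u], and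
    eliminating [x] between the two puts such a multiple in the cone. *)
Lemma unit_cone_total C0 : unit_cone C0 ->
  exists C, [/\ C0 `<=` C, unit_cone C & forall x, C x \/ C (- x)].
Proof.
case=> C00 C0D C0u C0N.
(* Joining [C0] to the members of a chain covers the empty chain as well. *)
pose P (A : set G) := unit_cone (C0 `|` A).
have [F FP totF|T [PT maxT]] := @Zorn_bigcup G P.
  split; first by left.
  - have step X x : F X -> (C0 `|` X) x -> (C0 `|` \bigcup_(X in F) X) x.
      by move=> FX [?|?]; [left|right; exists X].
    move=> x y [C0x|[X FX Xx]] [C0y|[Y FY Yy]].
    + by left; exact: C0D.
    + have [_ YD _ _] := FP _ FY.
      by apply: (step Y) => //; apply: YD; [left|right].
    + have [_ XD _ _] := FP _ FX.
      by apply: (step X) => //; apply: XD; [right|left].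
    + have [XY|YX] := totF _ _ FX FY.
        have [_ YD _ _] := FP _ FY.
        by apply: (step Y) => //; apply: YD; right => //; exact: XY.
      have [_ XD _ _] := FP _ FX.
      by apply: (step X) => //; apply: XD; right => //; exact: YX.
  - by move=> x; have [n] := C0u x; exists n; left.
  - move=> n [/C0N//|[X FX Xn]]; have [_ _ _ XN] := FP _ FX.
    by apply: (XN n); right.
pose C := C0 `|` T; exists C.
have coneC : unit_cone C := PT.
have [C_0 CD Cu CN] := PT.
(* By maximality, adding the multiples of [x] yields a negative multiple of
   [u] as soon as [x] is not already in the cone. *)
have ext x : ~ C x -> exists c m n, C c /\ c + x *+ m = - (u *+ n.+1).
  move=> nCx; pose D := [set z | exists2 c, C c & exists m, z = c + x *+ m].
  have CsubD : C `<=` D by move=> c Cc; exists c => //; exists 0%N; rewrite mulr0n addr0.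
  have C0D' : C0 `|` D = D.
    by apply/seteqP; split=> [z [C0z|//]|z Dz]; [apply: CsubD; left|right].
  apply: contrapT => nex; apply: (maxT D).
    split; first by move=> z Tz; apply: CsubD; right.
    move=> DT; apply: nCx; right; apply: DT.
    by exists 0; [left|exists 1%N; rewrite add0r].
  rewrite /P C0D'; split.
  - exact: CsubD.
  - move=> _ _ [c Cc [m ->]] [d Cd [p ->]].
    exists (c + d); first exact: CD.
    by exists (m + p)%N; rewrite mulrnDr addrACA.
  - by move=> z; have [n Cn] := Cu z; exists n; exact: CsubD.
  - by move=> n [c Cc [m zE]]; apply: nex; exists c, m, n.
split=> //; first by move=> x; left.
move=> x; apply: contrapT => /not_orP[/ext[c [m [n [Cc cE]]]] /ext[d [p [q [Cd dE]]]]].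
have combE : c *+ p + d *+ m = - (u *+ (n.+1 * p + q.+1 * m)).
  transitivity ((c + x *+ m) *+ p + (d + - x *+ p) *+ m).
    by rewrite !mulrnDl -!mulrnA mulNrn (mulnC p) addrACA subrr addr0.
  by rewrite cE dE !mulNrn -!mulrnA -opprD -mulrnDr.
case: p => [|p] in dE combE *.
  by rewrite mulr0n addr0 in dE; apply: (CN q); rewrite -dE.
apply: (CN (n.+1 * p.+1 + q.+1 * m).-1).
rewrite prednK ?addn_gt0 // -combE.
by apply: CD; exact: unit_cone_mulrn.
Qed.

End Cones.

Section ConeState.
Context (R : realType) (G : zmodType) (u : G).

(** The fractions k/(n+1) such that (n+1) x is at most k u for the preorder of
    the cone; their infimum is the value at [x] of the state. *)
Definition upper_ratios (C : set G) (x : G) : set R :=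
  [set r | exists (k : int) (n : nat),
     C (u *~ k - x *+ n.+1) /\ r = k%:~R / n.+1%:R].

(** The infimum [s] of the upper ratios is subadditive. For a total cone, a
    rational number below [s (- x)] is not an upper ratio of [- x], so its
    opposite is an upper ratio of [x]; this gives [s (- x) = - s x], hence
    additivity. *)
Lemma total_cone_state (C : set G) : unit_cone u C ->
  (forall x, C x \/ C (- x)) ->
  exists s : G -> R, [/\ forall x y, s (x + y) = s x + s y,
    forall x, C x -> 0 <= s x & s u = 1].
Proof.
move=> coneC totC; have [C0 CD Cu CN] := coneC.
have Cmul x n : C x -> C (x *+ n) by exact: unit_cone_mulrn.
have Ck (k : int) : C (u *~ k) -> 0 <= k.
  by case: k => // n; rewrite NegzE mulrNz => /CN.
pose A x := upper_ratios C x.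
have A0 x : A x !=set0.
  by have [n Cn] := Cu x; exists n%:R, n%:Z, 0%N; rewrite divr1 mulr1n.
have Alb x : has_lbound (A x).
  have [M CM] := Cu (- x); rewrite opprK in CM.
  exists (- M%:R) => r [k [n [Ckn ->]]].
  have /Ck : C (u *~ (k + M%:Z * n.+1%:Z)).
    have := CD _ _ Ckn (Cmul _ n.+1 CM).
    by rewrite mulrnDl (addrC (u *+ M *+ _)) addrA subrK mulrzDr mulrzA.
  rewrite -(ler0z R) rmorphD rmorphM /= => kM.
  by rewrite ler_pdivlMr ?ltr0n //; lra.
pose s x : R := inf (A x); exists s.
have s_le x r : A x r -> s x <= r by move=> Ar; exact: ge_inf.
have ge_s x l : (forall r, A x r -> l <= r) -> l <= s x.
  by move=> h; apply: lb_le_inf.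
have AD x y r t : A x r -> A y t -> A (x + y) (r + t).
  move=> [k [n [Cx ->]]] [l [m [Cy ->]]].
  exists (k * m.+1%:Z + l * n.+1%:Z), (n.+1 * m.+1).-1; rewrite prednK ?muln_gt0 //.
  split; last by rewrite rmorphD !rmorphM natrM addf_div ?pnatr_eq0.
  have := CD _ _ (Cmul _ m.+1 Cx) (Cmul _ n.+1 Cy).
  rewrite !mulrnBl addrACA -opprD -!mulrnA (mulnC m.+1) -mulrnDl.
  by rewrite mulrzDr !mulrzA.
have sub x y : s (x + y) <= s x + s y.
  rewrite -lerBlDr; apply: (ge_s _ _) => r Ar; rewrite lerBlDr -lerBlDl.
  by apply: (ge_s _ _) => t At; rewrite lerBlDl; apply: (s_le _ _); exact: AD.
have s0 : 0 <= s 0.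
  apply: (ge_s _ _) => r [k [n [+ ->]]]; rewrite mul0rn subr0 => /Ck k0.
  by rewrite divr_ge0 // ler0z.
have sN x : s (- x) = - s x.
  apply/eqP; rewrite eq_le andbC -subr_ge0 opprK addrC.
  rewrite (le_trans s0) /=; last by have := sub x (- x); rewrite subrr.
  rewrite leNgt; apply/negP => /rat_in_itvoo[q].
  rewrite in_itv /= => /andP[sxq qsx].
  pose n := `|denq q|%N.-1; pose k := numq q.
  have nE : (n.+1 : int) = denq q.
    by rewrite /n prednK ?absz_gt0 ?denq_neq0 // gez0_abs ?denq_ge0.
  have qE : ratr q = k%:~R / n.+1%:R :> R by rewrite /ratr -nE.
  have [Ckn|] := totC (u *~ k - - x *+ n.+1).
    by move: qsx; rewrite ltNge s_le // qE; exists k, n.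
  rewrite mulNrn opprK opprD -mulrNz => Ckn.
  have : s x <= - ratr q.
    by apply: (s_le _ _); exists (- k), n; rewrite qE rmorphN mulNr.
  by rewrite leNgt ltrNl sxq.
have sC x : C x -> 0 <= s x.
  move=> Cx; rewrite -oppr_le0 -sN; apply: (s_le _ _).
  by exists 0, 0%N; rewrite mulr0z mulr1n opprK add0r mul0r.
have su : s u <= 1.
  by apply: (s_le _ _); exists 1, 0%N; rewrite mulr1z mulr1n subrr divr1.
have sNu : s (- u) <= -1.
  by apply: (s_le _ _); exists (-1), 0%N; rewrite mulrNz mulr1z mulr1n subrr divr1.
split=> //.
  move=> x y; apply/eqP; rewrite eq_le sub /=.
  by have := sub (x + y) (- y); rewrite addrK sN lerBrDr.
by apply/eqP; rewrite eq_le su /= -lerN2 -sN.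
Qed.

End ConeState.

(** * Translation-invariant orders *)

Section DimensionGroup.
Context (G : porderZmodType) (pog : partially_ordered_group G).
Implicit Types x y z t : G.

Lemma legD x y z t : x <= y -> z <= t -> x + z <= y + t.
Proof.
move=> xy zt; apply: le_trans (pog z xy) _.
by rewrite ![y + _]addrC; exact: pog.
Qed.

Lemma subg_ge0 x y : (0 <= y - x) = (x <= y).
Proof.
by apply/idP/idP => [/pog - /(_ x)|/pog - /(_ (- x))]; rewrite ?subrK ?add0r ?subrr.
Qed.

Lemma legBlDr x y z : (x - y <= z) = (x <= z + y).
Proof. by rewrite -[LHS]subg_ge0 opprB addrA subg_ge0. Qed.

Lemma legBlDl x y z : (x - y <= z) = (x <= y + z).
Proof. by rewrite legBlDr addrC. Qed.

Lemma legBrDr x y z : (x <= y - z) = (x + z <= y).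
Proof. by rewrite -[LHS]subg_ge0 -[RHS]subg_ge0 opprD -addrA [- z - x]addrC. Qed.

Lemma legN2 x y : (- x <= - y) = (y <= x).
Proof. by rewrite -[LHS]subg_ge0 opprK addrC subg_ge0. Qed.

Lemma legDr x y : 0 <= y -> x <= x + y.
Proof. by move=> y0; rewrite -[X in X <= _]addr0; apply: legD. Qed.

Lemma legMn n x y : x <= y -> x *+ n <= y *+ n.
Proof.
move=> xy; elim: n => [|n IH]; first by rewrite !mulr0n.
by rewrite !mulrSr; exact: legD.
Qed.

Lemma gegMn0 n x : 0 <= x -> 0 <= x *+ n.
Proof. by move=> /(legMn n); rewrite mul0rn. Qed.

Lemma legMn2l n m x : 0 <= x -> (n <= m)%N -> x *+ n <= x *+ m.
Proof.
move=> x0 nm; rewrite -(subnKC nm) mulrnDr -[X in X <= _]addr0.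
by apply: legD => //; exact: gegMn0.
Qed.

(** * The monoid of intervals *)

Lemma Lambda_Lambda_add a b : Lambda G a -> Lambda G b -> Lambda G (Lambda_add a b).
Proof.
move=> [[x0 ax0] dira lowa] [[y0 by0] dirb lowb]; split.
- by exists (x0 + y0), x0, y0.
- move=> z1 z2 [x1 [y1 [ax1 by1 z1le]]] [x2 [y2 [ax2 by2 z2le]]].
  have [x [ax x1x x2x]] := dira _ _ ax1 ax2.
  have [y [by_ y1y y2y]] := dirb _ _ by1 by2.
  exists (x + y); split; first by exists x, y.
    by apply: le_trans z1le _; exact: legD.
  by apply: le_trans z2le _; exact: legD.
- move=> z t [x [y [ax by_ tle]]] zt; exists x, y; split=> //.
  exact: le_trans tle.
Qed.

Lemma Lambda_addC (a b : set G) : Lambda_add a b = Lambda_add b a.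
Proof.
by apply/seteqP; split=> z [x [y [ax by_ ?]]]; exists y, x; rewrite addrC.
Qed.

Lemma Lambda_addA (a b c : set G) :
  Lambda_add a (Lambda_add b c) = Lambda_add (Lambda_add a b) c.
Proof.
apply/seteqP; split=> z.
  move=> [x [t [ax [y [w [by_ cw tle]]] zle]]].
  exists (x + y), w; split=> //; first by exists x, y.
  by apply: le_trans zle _; rewrite -addrA; exact: legD.
move=> [t [w [[x [y [ax by_ tle]]] cw zle]]].
exists x, (y + w); split=> //; first by exists y, w.
by apply: le_trans zle _; rewrite addrA; exact: legD.
Qed.

Lemma Lambda_add0 a : Lambda G a -> Lambda_add [set z | z <= 0] a = a.
Proof.
move=> [_ _ lowa]; apply/seteqP; split=> z.
  move=> [x [y [x0 ay zle]]]; apply: (lowa _ y) => //.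
  by apply: le_trans zle _; rewrite -[X in _ <= X]add0r; exact: legD.
by move=> az; exists 0, z; split; rewrite ?add0r //=.
Qed.

Lemma Lambda_le0 : Lambda G [set z | z <= 0].
Proof.
split; first by exists 0 => /=.
- by move=> x y /= x0 y0; exists 0.
- by move=> x y /= y0 xy; exact: le_trans y0.
Qed.

(** * Smallness in an unperforated group *)

Context (unperf : unperforated G).

Lemma legMn_cancel n x y : (0 < n)%N -> x *+ n <= y *+ n -> x <= y.
Proof.
move=> n0; rewrite -(subg_ge0 (x *+ n)) -mulrnBl => /(unperf n0).
by rewrite subg_ge0.
Qed.

Context (u : G) (unit_u : order_unit u) (interp : interpolation G).
Implicit Types (c : G) (a b : set G) (k : nat).

(** A one-sided and division-free form of: the norm of [x] is at most 2^-k.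
    Dyadic scales are those that interpolation can reach by halving. *)
Definition small k x := x *+ 2 ^ k <= u.

Let u0 : 0 <= u. Proof. by case: unit_u. Qed.

Lemma small_le k x y : x <= y -> small k y -> small k x.
Proof. by move=> xy; apply: le_trans; exact: legMn. Qed.

Lemma small0 k x : x <= 0 -> small k x.
Proof. by move=> /(small_le (k := k)); apply; rewrite /small mul0rn. Qed.

Lemma smallD k x y : small k.+1 x -> small k.+1 y -> small k (x + y).
Proof.
move=> sx sy; apply: (legMn_cancel (n := 2%N)) => //.
rewrite -mulrnA -expnSr mulrnDl mulr2n.
exact: legD.
Qed.

Lemma small_mono j k x : (k <= j)%N -> small j x -> small k x.
Proof.
move=> /subnKC <-; elim: (j - k)%N => [|n IH]; first by rewrite addn0.
rewrite addnS => sx; apply: IH; rewrite -[x]addr0; apply: smallD => //.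
exact: small0.
Qed.

(** By induction it is enough to halve: from [2 x' <= v] and [2 y' <= v], find
    [d] above [x'] and [y'] with [2 d <= v]. A first interpolation gives [c]
    between [x'], [y'] and [v - x'], [v - y'] (two bounds that follow from
    unperforation); a second one gives [d] below both [c] and [v - c]. *)
Lemma small_directed k x y : small k x -> small k y ->
  exists c, [/\ x <= c, y <= c & small k c].
Proof.
rewrite /small; elim: k u => [v xv yv|k IH v xv yv].
  by exists v; rewrite mulr1n.
have half z t : z *+ 2 <= v -> t *+ 2 <= v -> z <= v - t.
  move=> zv tv; rewrite legBrDr //.
  apply: (legMn_cancel (n := 2%N)) => //.
  by rewrite mulrnDl mulr2n [v *+ 2]mulr2n; apply: legD.
rewrite expnSr !mulrnA in xv yv.
set x' := x *+ 2 ^ k in xv; set y' := y *+ 2 ^ k in yv.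
have [c [xc yc cx cy]] : exists c, [/\ x' <= c, y' <= c, c <= v - x' & c <= v - y'].
  by apply: interp; apply: half.
have swap z : c <= v - z -> z <= v - c by rewrite !legBrDr // addrC.
have [d [xd yd dc dv]] : exists d, [/\ x' <= d, y' <= d, d <= c & d <= v - c].
  by apply: interp => //; exact: swap.
have [e [xe ye ed]] := IH d xd yd.
exists e; split=> //; rewrite expnSr mulrnA.
apply: le_trans (legMn 2 ed) _.
by rewrite mulr2n; apply: le_trans (legD dc dv) _; rewrite addrC subrK.
Qed.

Lemma small_pos k x : small k x -> exists c, [/\ 0 <= c, x <= c & small k c].
Proof. by move=> sx; apply: small_directed => //; exact: small0. Qed.

Context (arch : archimedean_group G).

Lemma small_archimedean x : (forall k, small k x) -> x <= 0.
Proof.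
move=> sx; apply: (@arch _ u) => n.
have [c [c0 xc sc]] := small_pos (sx n).
apply: le_trans (legMn n xc) _; apply: le_trans _ sc.
by apply: legMn2l => //; apply/ltnW/ltn_expl.
Qed.

(** * The canonical norm and the closure of intervals *)

Context (R : realType).

Lemma unorm_le k x : small k x -> small k (- x) -> unorm R u x <= (2 ^ k)%:R^-1.
Proof.
move=> sx sNx; apply: ge_inf.
  by exists 0 => r [m [n [_ _ _ ->]]]; exact: divr_ge0.
exists 1%N, (2 ^ k)%N; split=> //; rewrite ?expn_gt0 ?mulr1n ?mul1r //.
by rewrite -(opprK (x *+ _)) legN2 // -mulNrn.
Qed.

Lemma unorm_lt k x : unorm R u x < (2 ^ k)%:R^-1 -> small k x /\ small k (- x).
Proof.
move/inf_lt => [].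
  have [_ unit] := unit_u.
  have [n [n0 xn]] := unit x; have [m [m0 xm]] := unit (- x).
  exists (n + m)%:R, (n + m)%N, 1%N; rewrite divr1 mulr1n; split=> //.
    rewrite -[x]opprK legN2 //; apply: le_trans xm _.
    by apply: legMn2l => //; exact: leq_addl.
  by apply: le_trans xn _; apply: legMn2l => //; exact: leq_addr.
move=> _ [m [n [n0 lex gex ->]]].
rewrite ltr_pdivrMr ?ltr0n // mulrC ltr_pdivlMr ?ltr0n ?expn_gt0 //.
rewrite -natrM ltr_nat => /ltnW mn.
have aux y : y *+ n <= u *+ m -> small k y.
  move=> yn; apply: (legMn_cancel n0).
  rewrite -mulrnA mulnC mulrnA; apply: le_trans (legMn _ yn) _.
  by rewrite -mulrnA; apply: legMn2l.
split; apply: aux => //.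
by rewrite mulNrn -(opprK (u *+ m)) legN2.
Qed.

Lemma exp2_inv_lt (e : R) : 0 < e -> exists k, (2 ^ k)%:R^-1 < e.
Proof.
move=> e0; exists (Num.bound e^-1).
rewrite invf_plt ?posrE ?ltr0n ?expn_gt0 //.
apply: lt_trans (archi_boundP _) _; first by rewrite invr_ge0 ltW.
by rewrite ltr_nat ltn_expl.
Qed.

(** For an interval, the closure for the canonical norm: approximation from one
    side is enough, and no real number is involved. *)
Definition lclosure a : set G := [set x | forall k, exists2 y, a y & small k (x - y)].

Lemma sub_lclosure a : a `<=` lclosure a.
Proof. by move=> x ax k; exists x => //; rewrite subrr; apply: small0. Qed.

(** If [x - y] is small, it is bounded by a small positive [c]; then [x - c] is
    below [y], hence in [a], and near [x]. *)
Lemma closed_lclosure_sub a :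
  Lambda G a -> closed (a : set (normed R u)) -> lclosure a `<=` a.
Proof.
move=> [_ _ lowa] ca x nx; apply: contrapT => nax.
have /norm_openE := closed_openC ca.
move=> /(_ x nax)[e e0 eA].
have [k ke] := exp2_inv_lt e0.
have [y ay sxy] := nx k.
have [c [c0 xyc sc]] := small_pos sxy.
apply: (eA (x - c)); last first.
  by apply: (lowa _ y) => //; rewrite legBlDr // addrC -legBlDr.
rewrite /= opprD opprK addrA subrr add0r.
apply: le_lt_trans ke; apply: unorm_le => //.
by apply: small0; rewrite -oppr0 legN2.
Qed.

Lemma lclosure_sub_closed b : lclosure b `<=` b -> closed (b : set (normed R u)).
Proof.
move=> nb; rewrite -[b]setCK; apply: open_closedC; apply/norm_openE => x nbx.
have /existsNP[k nk] : ~ lclosure b x by move=> /nb.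
exists ((2 ^ k)%:R^-1); first by rewrite invr_gt0 ltr0n expn_gt0.
by move=> y /= /unorm_lt[sxy _] by_; apply: nk; exists y.
Qed.

(** * Decomposing limits of sums *)

Context (complete : norm_complete R u).

(** The bounds on the steps from [x k.+1] onwards add up to 2^-k, twice the bound
    2^-k.+1 on the first of these steps; whence the shifts of indices. *)
Lemma geometric_limit (x : nat -> G) :
  (forall k, small k (x k - x k.+1)) -> (forall k, small k (x k.+1 - x k)) ->
  exists l, forall k, exists j, [/\ (k <= j)%N, small k (x j - l) & small k (l - x j)].
Proof.
move=> dx ix.
have teleD j k : small k (x k.+1 - x (k.+1 + j)%N).
  elim: j k => [k|j IH k]; first by rewrite addn0 subrr; exact: small0.
  by rewrite -(subrKA (x k.+2)) -addSnnS; apply: smallD.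
have teleI j k : small k (x (k.+1 + j)%N - x k.+1).
  elim: j k => [k|j IH k]; first by rewrite addn0 subrr; exact: small0.
  by rewrite -(subrKA (x k.+2)) -addSnnS; apply: smallD.
have cauchy m n k : (k.+2 <= m)%N -> (k.+2 <= n)%N -> small k (x m - x n).
  move=> /subnKC <- /subnKC <-; rewrite -(subrKA (x k.+2)).
  exact: smallD.
have [|l xl] := @complete x.
  move=> e /exp2_inv_lt[k ke]; exists k.+2 => m n km kn.
  by apply: le_lt_trans ke; apply: unorm_le; rewrite ?opprB; exact: cauchy.
exists l => k.
have e0 : 0 < (2 ^ k)%:R^-1 :> R by rewrite invr_gt0 ltr0n expn_gt0.
have /cvgrPdist_lt/(_ _ e0)[N _ NP] := xl.
exists (maxn k N); split; first exact: leq_maxl.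
  have /NP : (N <= maxn k N)%N := leq_maxr _ _.
  rewrite /= sub0r normrN => /(le_lt_trans (ler_norm _)) /unorm_lt[+ _]; exact.
have /NP : (N <= maxn k N)%N := leq_maxr _ _.
rewrite /= sub0r normrN => /(le_lt_trans (ler_norm _)) /unorm_lt[_].
by rewrite opprB.
Qed.

(** Let [y] in [a] and [w] in [b] satisfy [x <= y + w + c] with [c] positive and
    small. Any [p] between [x - (w + c)] and [y + c] is nearly in [a], while
    [x - p] is nearly in [b]. At the next scale, with larger [y2], [w2] and a
    smaller [c1], interpolation finds a new such [p] within [c] of the previous
    one; the limit of these elements is exactly decomposed. *)
Lemma lclosure_add a b x : Lambda G a -> Lambda G b ->
  lclosure (Lambda_add a b) x -> exists2 p, lclosure a p & lclosure b (x - p).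
Proof.
move=> [_ dira lowa] [_ dirb lowb] nx.
pose inv k p := exists y w c,
  [/\ a y, b w, 0 <= c & small k c] /\ (x - (w + c) <= p /\ p <= y + c).
have cover y w c z : z <= y + w -> 0 <= c -> x - z <= c -> x - (w + c) <= y + c.
  move=> zyw c0; rewrite !legBlDr // => xcz; apply: le_trans xcz _.
  rewrite addrA (addrC y c) -[c + y + w]addrA; apply: le_trans (legDr _ c0).
  exact: legD.
have base : exists p, inv 0%N p.
  have [z [y [w [ay bw zyw]]] sz] := nx 0%N.
  have [c [c0 xzc sc]] := small_pos sz.
  by exists (y + c), y, w, c; split=> //; split=> //; exact: cover zyw _ xzc.
(* The elements [y2] and [w2] are taken above [y] and [w], so that
   [p - c <= y <= y2] and [x - (w2 + c) <= p]. *)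
have step k p : inv k p ->
    exists q, inv k.+1 q /\ (small k (p - q) /\ small k (q - p)).
  move=> [y [w [c [[ay bw c0 sc] [xp py]]]]].
  have [z [y1 [w1 [ay1 bw1 zyw]]] sz] := nx k.+1.
  have [c1 [c10 xzc sc1]] := small_pos sz.
  have [y2 [ay2 yy2 y1y2]] := dira _ _ ay ay1.
  have [w2 [bw2 ww2 w1w2]] := dirb _ _ bw bw1.
  have [q [Lq1 Lq2 qU1 qU2]] : exists q,
    [/\ x - (w2 + c1) <= q, p - c <= q, q <= y2 + c1 & q <= p + c].
    apply: interp.
    - by apply: cover xzc => //; apply: le_trans zyw _; exact: legD.
    - move: xp; rewrite !legBlDr // => xp; apply: le_trans xp _.
      rewrite -addrA; apply: legD => //; rewrite addrC; apply: legD => //.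
      exact: le_trans ww2 (legDr _ c10).
    - rewrite legBlDr //; apply: le_trans py _; apply: legD => //.
      exact: le_trans yy2 (legDr _ c10).
    - by rewrite legBlDr //; apply: le_trans (legDr _ c0); exact: legDr.
  exists q; split; first by exists y2, w2, c1.
  split; apply: small_le sc; last by rewrite legBlDl.
  by rewrite legBlDr // -legBlDl.
have [f fP] : exists f : nat -> G -> G, forall k p, inv k p ->
    inv k.+1 (f k p) /\ (small k (p - f k p) /\ small k (f k p - p)).
  have /choice[f fP] : forall kp : nat * G, exists q, inv kp.1 kp.2 ->
      inv kp.1.+1 q /\ (small kp.1 (kp.2 - q) /\ small kp.1 (q - kp.2)).
    move=> [k p] /=; have [/step[q qP]|np] := pselect (inv k p); first by exists q.
    by exists p.
  by exists (fun k p => f (k, p)) => k p; exact: (fP (k, p)).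
have [p0 p0P] := base.
pose p := nat_rect (fun=> G) p0 f.
have invp k : inv k (p k) by elim: k => // k /fP[].
have [l lP] : exists l, forall k, exists j,
    [/\ (k <= j)%N, small k (p j - l) & small k (l - p j)].
  by apply: geometric_limit => // k; have [_ []] := fP _ _ (invp k).
(* The errors [l - p j] and [c] are taken at scale [k.+1], for their sum to be
   small at scale [k]. *)
exists l => k; have [j [kj pl lp]] := lP k.+1;
  have [y [w [c [[ay bw c0 sc] [xp py]]]]] := invp j;
  have {}sc := small_mono kj sc.
  exists y => //; apply: small_le (smallD lp sc).
  rewrite legBlDr // -addrA (addrC c) -[X in X <= _](subrK (p j) l).
  exact: legD.
exists w => //; apply: small_le (smallD pl sc).
rewrite !legBlDr // -!addrA [c + (w + l)]addrA [c + w + l]addrC addKr [c + w]addrC.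
by rewrite -legBlDr.
Qed.

(** * Suprema of intervals over the state space *)

Implicit Types s : states R u.

Lemma stateD s x y : val s (x + y) = val s x + val s y.
Proof. by have [+ _ _] := set_mem (valP s); exact. Qed.

Lemma state_ge0 s x : 0 <= x -> 0 <= val s x.
Proof. by have [_ + _] := set_mem (valP s); exact. Qed.

Lemma state_unit s : val s u = 1.
Proof. by have [_ _] := set_mem (valP s). Qed.

Lemma state0 s : val s 0 = 0.
Proof. by apply: (addrI (val s 0)); rewrite -stateD !addr0. Qed.

Lemma stateB s x y : val s (x - y) = val s x - val s y.
Proof. by apply: (addIr (val s y)); rewrite -stateD !subrK. Qed.

Lemma stateMn s x n : val s (x *+ n) = val s x *+ n.
Proof. by elim: n => [|n IH]; rewrite ?mulr0n ?state0 // !mulrSr stateD IH. Qed.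

Lemma state_le s x y : x <= y -> val s x <= val s y.
Proof. by rewrite -(subg_ge0) => /(state_ge0 s); rewrite stateB subr_ge0. Qed.

Lemma state_small s k x : small k x -> val s x <= (2 ^ k)%:R^-1.
Proof.
move=> /(state_le s); rewrite stateMn state_unit -[_ *+ _]mulr_natr.
by rewrite -ler_pdivlMr ?ltr0n ?expn_gt0 // mul1r.
Qed.

Lemma sup_phi_ub s (a : set G) x : a x -> ((val s x)%:E <= sup_phi R u a s)%E.
Proof. by move=> ax; apply: ereal_sup_ubound; exists x. Qed.

Lemma sup_phi_lub s (a : set G) (M : \bar R) :
  (forall x, a x -> ((val s x)%:E <= M)%E) -> (sup_phi R u a s <= M)%E.
Proof. by move=> h; apply: ge_ereal_sup => _ [x ax <-]; exact: h. Qed.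

Lemma sup_phi_add a b : Lambda G a -> Lambda G b ->
  sup_phi R u (Lambda_add a b) = (fun s => sup_phi R u a s + sup_phi R u b s)%E.
Proof.
move=> [[x0 ax0] _ _] [[y0 by0] _ _]; apply/funext => s.
apply/eqP; rewrite eq_le; apply/andP; split.
  apply: sup_phi_lub => z [x [y [ax by_ /(state_le s)]]].
  rewrite stateD -lee_fin => /le_trans; apply.
  by rewrite EFinD; apply: leeD; exact: sup_phi_ub.
case E: (sup_phi R u (Lambda_add a b) s) => [M| |]; last first.
- have : ((val s (x0 + y0))%:E <= sup_phi R u (Lambda_add a b) s)%E.
    by apply: sup_phi_ub; exists x0, y0.
  by rewrite E.
- exact: leey.
have abM x y : a x -> b y -> (val s x + val s y <= M)%R.
  move=> ax by_; rewrite -lee_fin -E -stateD.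
  by apply: sup_phi_ub; exists x, y.
have aM y : b y -> (sup_phi R u a s <= (M - val s y)%:E)%E.
  move=> by_; apply: sup_phi_lub => x ax.
  by rewrite lee_fin lerBrDr; exact: abM.
have afin : sup_phi R u a s \is a fin_num.
  rewrite fin_real // (lt_le_trans _ (sup_phi_ub s ax0)) ?ltNyr //=.
  by rewrite (le_lt_trans (aM _ by0)) ?ltry.
rewrite -(fineK afin) -leeBrDl // -EFinB; apply: sup_phi_lub => y by_.
have := aM _ by_; rewrite -(fineK afin) !lee_fin; lra.
Qed.

Lemma sup_phi_le0 : sup_phi R u [set z | z <= 0] = (fun=> 0%E).
Proof.
apply/funext => s; apply/eqP; rewrite eq_le; apply/andP; split.
  by apply: sup_phi_lub => z /(state_le s); rewrite state0 lee_fin.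
by have := @sup_phi_ub s [set z | z <= 0] 0 (lexx _); rewrite state0.
Qed.

Lemma sup_phi_below q : Sigma R u q -> sup_phi R u (phi_below R u q) = q.
Proof.
move=> [b Lb <-]; apply/funext => s; apply/eqP; rewrite eq_le; apply/andP; split.
  by apply: sup_phi_lub => x; exact.
by apply: sup_phi_lub => x bx; apply: sup_phi_ub => t; exact: sup_phi_ub.
Qed.

(** If no [w y] is positive, the group elements [g] with [g + w y *+ m] positive
    for some [m] and [y] form a cone, which is proper by unperforation. A state
    that is positive on this cone is nonpositive on all [w y] at once, since the
    cone contains [- w y]. *)
Lemma positive_of_states a (w : G -> G) : Lambda G a ->
  (forall x y, x <= y -> w x <= w y) ->
  (forall s : states R u, exists2 y, a y & 0 < val s (w y)) ->
  exists2 y, a y & 0 <= w y.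
Proof.
move=> [[y0 ay0] dira _] wmono pos.
have [_ unit] := unit_u.
apply: contrapT => nex.
pose C : set G := [set g | exists y m, a y /\ 0 <= g + w y *+ m].
have Cpos g : 0 <= g -> C g by exists y0, 0%N; rewrite mulr0n addr0.
have coneC : unit_cone u C.
  split.
  - exact: Cpos.
  - move=> g h [y [m [ay gm]]] [z [n [az hn]]].
    have [t [at_ yt zt]] := dira _ _ ay az.
    exists t, (m + n)%N; split=> //; rewrite mulrnDr addrACA -[0]addr0.
    apply: legD => //; [apply: le_trans gm _|apply: le_trans hn _];
      by apply: legD => //; apply: legMn => //; exact: wmono.
  - move=> x; have [n [_ xn]] := unit x; exists n; apply: Cpos.
    by rewrite subg_ge0.
  - move=> n [y [m [ay]]]; rewrite addrC subg_ge0 // => nm.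
    have m0 : 0 <= w y *+ m by apply: le_trans nm; exact: gegMn0.
    apply: nex; case: m m0 nm => [_|m m0 nm]; last first.
      by exists y => //; exact: unperf m0.
    (* A nonpositive order unit forces the group to be trivial. *)
    rewrite mulr0n => n0; exists y => //.
    have [p [_ wp]] := unit (- w y).
    have ule0 : u <= 0.
      by apply: (legMn_cancel (n := n.+1)) => //; rewrite mul0rn.
    have : - w y <= 0 by apply: le_trans wp _; rewrite -(mul0rn _ p); exact: legMn.
    by rewrite -[X in _ <= X]oppr0 legN2.
have [D [CD coneD totD]] := unit_cone_total coneC.
have [s [sD sge su]] := total_cone_state R coneD totD.
have sS : states R u s by split=> // x /Cpos /CD /sge.
have [y ay] := pos (SigSub (mem_set sS)).
rewrite /= ltNge => /negP; apply.
have s0 : s 0 = 0 by apply: (addrI (s 0)); rewrite -sD !addr0.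
have -> : s (w y) = - s (- w y) by apply/eqP; rewrite -addr_eq0 -sD subrr s0.
rewrite oppr_le0; apply/sge/CD; exists y, 1%N; split=> //.
by rewrite mulr1n addNr.
Qed.

(** [positive_of_states] applied to [w y = u - (x - y) *+ 2 ^ k]: a state that is
    nonpositive on [w y] satisfies [s y <= s x - 2^-k], so if this held for all
    [y] of [a], the supremum of [a] at [s] would be less than [s x]. *)
Lemma phi_below_sup a : Lambda G a -> phi_below R u (sup_phi R u a) = lclosure a.
Proof.
move=> La; apply/seteqP; split=> x.
  move=> xa k.
  have [|s|y ay wy] := @positive_of_states a (fun y => u - (x - y) *+ 2 ^ k) La.
  - move=> y z yz; apply: legD => //; rewrite legN2 //; apply: legMn => //.
    by apply: legD => //; rewrite legN2.
  - apply: contrapT => nex.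
    have : (sup_phi R u a s <= (val s x - (2 ^ k)%:R^-1)%:E)%E.
      apply: sup_phi_lub => y ay; rewrite lee_fin.
      have : ~ 0 < val s (u - (x - y) *+ 2 ^ k) by move=> h; apply: nex; exists y.
      move/negP; rewrite -leNgt stateB state_unit stateMn stateB subr_le0.
      rewrite -[(_ - _) *+ _]mulr_natr -ler_pdivrMr ?ltr0n ?expn_gt0 // mul1r; lra.
    have k0 : 0 < (2 ^ k)%:R^-1 :> R by rewrite invr_gt0 ltr0n expn_gt0.
    by move/(le_trans (xa s)); rewrite lee_fin /=; lra.
  - by exists y => //; rewrite /small -subg_ge0.
move=> nx s; apply/lee_addgt0Pr => e /exp2_inv_lt[k ke].
have [y ay /(state_small s)] := nx k; rewrite stateB => sxy.
apply: le_trans (leeD (sup_phi_ub s ay) (lexx e%:E)).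
by rewrite -EFinD lee_fin -lerBlDl; apply: le_trans sxy (ltW ke).
Qed.

(** * Closed intervals *)

Context (dirG : directed_group G).

(** For the directedness, let [b] be the interval of the common lower bounds of
    [- x0] and [- x1]. As [x0] and [x1] are approximated by the same [y] of [a]
    with the same error, 0 is in the closure of [a + b], and [lclosure_add]
    writes it as [p + (- p)]; that [- p] is in the closure of [b] means that
    [x0, x1 <= p]. *)
Lemma Lambda_lclosure a : Lambda G a -> Lambda G (lclosure a).
Proof.
move=> La; have [[y0 ay0] dira lowa] := La; split.
- by exists y0; exact: sub_lclosure.
- move=> x0 x1 nx0 nx1.
  pose b : set G := [set w | w <= - x0 /\ w <= - x1].
  have Lb : Lambda G b.
    split.
    - have [z [x0z x1z]] := dirG x0 x1; exists (- z).
      by split; rewrite legN2.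
    - move=> v w [v0 v1] [w0 w1].
      by have [c [vc wc c0 c1]] := interp v0 v1 w0 w1; exists c.
    - by move=> v w [w0 w1] vw; split; exact: le_trans vw _.
  have nab : lclosure (Lambda_add a b) 0.
    move=> k; have [z0 az0 s0] := nx0 k; have [z1 az1 s1] := nx1 k.
    have [y [ay zy0 zy1]] := dira _ _ az0 az1.
    have [c [c0 c1 sc]] := small_directed s0 s1.
    exists (- c); last by rewrite sub0r opprK.
    have below x z : z <= y -> x - z <= c -> - (y + c) <= - x.
      rewrite legN2 // legBlDr // => zy xz; apply: le_trans xz _.
      by rewrite addrC; exact: legD.
    exists y, (- (y + c)); split=> //; last by rewrite opprD addrA subrr add0r.
    by split; [exact: below c0|exact: below c1].
  have [p np nb] := lclosure_add La Lb nab.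
  have above x : (forall w, b w -> w <= - x) -> x <= p.
    move=> bx; rewrite -[x <= p]subg_ge0 // -[0 <= _]legN2 // oppr0 opprB.
    apply: small_archimedean => // k; have [w bw sw] := nb k.
    apply: small_le sw => //; rewrite sub0r addrC; apply: legD => //.
    by rewrite -[x]opprK legN2 //; exact: bx.
  by exists p; split=> //; apply: above => w [].
- move=> x y ny xy k; have [z az sz] := ny k.
  by exists z => //; apply: small_le sz => //; exact: legD.
Qed.

Lemma lclosure_idem a : lclosure (lclosure a) `<=` lclosure a.
Proof.
move=> x nnx k; have [y ny sy] := nnx k.+1; have [z az sz] := ny k.+1.
by exists z => //; rewrite -(subrKA y); exact: smallD.
Qed.

Lemma lclosure_Lambda_cl a : Lambda_cl R u a -> lclosure a = a.
Proof.
move=> [La ca]; apply/seteqP; split; last exact: sub_lclosure.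
exact: closed_lclosure_sub La ca.
Qed.

Lemma Lambda_cl_lclosure a : Lambda G a -> Lambda_cl R u (lclosure a).
Proof.
move=> La; split; first exact: Lambda_lclosure.
by apply: lclosure_sub_closed => //; exact: lclosure_idem.
Qed.

Lemma Lambda_cl_add a b : Lambda_cl R u a -> Lambda_cl R u b ->
  Lambda_cl R u (Lambda_add a b).
Proof.
move=> Ca Cb; have [La _] := Ca; have [Lb _] := Cb.
have Lab := Lambda_Lambda_add La Lb.
split=> //; apply: lclosure_sub_closed => // x nx.
have [p] := lclosure_add La Lb nx.
rewrite (lclosure_Lambda_cl Ca) (lclosure_Lambda_cl Cb) => ap bp.
by exists p, (x - p); split=> //; rewrite addrC subrK.
Qed.

Lemma Lambda_cl_le0 : Lambda_cl R u [set z | z <= 0].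
Proof.
split; first exact: Lambda_le0.
apply: lclosure_sub_closed => // x nx; apply: small_archimedean => // k.
have [y /= y0 sy] := nx k; apply: small_le sy => //.
by rewrite -{1}[x]subr0; apply: legD => //; rewrite legN2.
Qed.

End DimensionGroup.

(** * The isomorphism *)

Theorem corollary3p2 (R : realType) (G : porderZmodType) (u : G)
    (dimG : dimension_group G) (archG : archimedean_group G)
    (unit_u : order_unit u) (completeG : norm_complete R u) :
  [/\ ordered_monoid_iso (Sigma_structure R u) (Lambda_cl_structure R u)
        (phi_below R u),
      forall q : states R u -> \bar R,
        Sigma R u q -> sup_phi R u (phi_below R u q) = q
    & forall a : set G,
        Lambda_cl R u a -> phi_below R u (sup_phi R u a) = a].
Proof.
have [pog dirG unperf interp] := dimG.
have below_sup a : Lambda_cl R u a -> phi_below R u (sup_phi R u a) = a.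
  by move=> Ca; rewrite phi_below_sup //; [exact: lclosure_Lambda_cl Ca|case: Ca].
have below_cl q : Sigma R u q -> Lambda_cl R u (phi_below R u q).
  by move=> [a La <-]; rewrite phi_below_sup //; exact: Lambda_cl_lclosure.
have sup_add a b : Lambda_cl R u a -> Lambda_cl R u b ->
    sup_phi R u (Lambda_add a b) = (fun s => sup_phi R u a s + sup_phi R u b s)%E.
  by move=> [La _] [Lb _]; exact: sup_phi_add.
have zero_cl : Lambda_cl R u [set z | z <= 0] by exact: Lambda_cl_le0.
split=> //; last exact: sup_phi_below.
split.
- split=> /=.
  + by exists [set z | z <= 0]; [case: zero_cl|exact: sup_phi_le0].
  + move=> _ _ [a La <-] [b Lb <-]; exists (Lambda_add a b).
      exact: Lambda_Lambda_add.
    exact: sup_phi_add.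
  + by move=> p q r _ _ _; apply/funext => s; rewrite addeA.
  + by move=> p q _ _; apply/funext => s; rewrite addeC.
  + by move=> p _; apply/funext => s; rewrite add0e.
  + by [].
  + by move=> p q _ _ pq qp; apply/funext => s; apply/le_anti; rewrite pq qp.
  + by move=> p q r _ _ _ pq qr s; exact: le_trans (pq s) (qr s).
  + by move=> p q r _ _ _ pq s; apply: leeD2r.
- split=> /=.
  + exact: zero_cl.
  + by move=> a b; exact: Lambda_cl_add.
  + by move=> a b c _ _ _; exact: Lambda_addA.
  + by move=> a b _ _; exact: Lambda_addC.
  + by move=> a [La _]; exact: Lambda_add0.
  + by move=> a _; exact: subset_refl.
  + by move=> a b _ _ ab ba; apply/seteqP.
  + by move=> a b c _ _ _ ab bc; exact: subset_trans ab bc.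
  + by move=> a b c _ _ _ ab z [x [y [ax cy zle]]]; exists x, y; split=> //; exact: ab.
- split=> /=.
  + exact: below_cl.
  + move=> p q /set_mem Sp /set_mem Sq pq.
    by rewrite -(sup_phi_below Sp) pq sup_phi_below.
  + by move=> a Ca; exists (sup_phi R u a); [exists a => //; case: Ca|exact: below_sup].
- by rewrite /= -(sup_phi_le0 pog) below_sup.
- move=> p q Sp Sq /=.
  have [Cp Cq] := (below_cl _ Sp, below_cl _ Sq).
  rewrite -{1}(sup_phi_below Sp) -{1}(sup_phi_below Sq) -sup_add // below_sup //.
  exact: Lambda_cl_add.
- move=> p q Sp Sq /=; split=> [pq x xp s|pq s]; first exact: le_trans (xp s) (pq s).
  rewrite -(sup_phi_below Sp) -(sup_phi_below Sq).
  by apply: sup_phi_lub => x /pq xq; exact: sup_phi_ub.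
Qed.
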